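(* Let $S\mapsto G(S)$ be a functor from the category of subsets of $\mathbb{Z}$ with inclusions as morphisms to the category of finitely generated groups and surjective homomorphisms. Suppose that $G(\emptyset)$ acts freely and cocompactly on a simplicial graph $K(\emptyset)$ in such a way that any two distinct vertices in the same $G(\emptyset)$-orbit are at edge path distance at least four. Let $K(S)$, $J(S)=W_{K(S)}\rtimes G(S)$, the generating sets of $J(S)$ and $G(S)$, the associated word lengths $l_{J(S)}$, $l_{G(S)}$, and the integer $N_1$ be as defined in the context, and put $N:=2N_1$. For all $S\subseteq T\subseteq\mathbb{Z}$, if $w\in J(S)$ is in the kernel of $J(S)\rightarrow J(T)$ and $l_{J(S)}(w)>N$, then there is $g\in G(S)-\{1\}$ with $l_{G(S)}(g)\leq l_{J(S)}(w)$ so that $g$ is in the kernel of $G(S)\rightarrow G(T)$.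
   Context: For a simplicial graph $K$ with vertex set $V(K)$, $W_K$ denotes the right-angled Coxeter group with generating set $V(K)$ and relators: $v^2=1$ for each $v\in V(K)$, and $vw=wv$ whenever $\{v,w\}$ is an edge of $K$. An action of a group $G$ on $K$ by automorphisms induces an action on $W_K$, giving a semidirect product $W_K\rtimes G$. For $S\subseteq\mathbb{Z}$, $K(S)$ is the quotient of $K(\emptyset)$ by the kernel of $G(\emptyset)\to G(S)$, so that $G(S)$ acts freely and cocompactly on $K(S)$, and $J(S):=W_{K(S)}\rtimes G(S)$. For $S\subseteq T$ the maps $K(S)\to K(T)$ and $G(S)\to G(T)$ induce a surjective homomorphism $J(S)\to J(T)$, making $J$ a functor. Generating sets: fix a finite generating set for $G(\emptyset)$ and a set $V'$ of $G(\emptyset)$-orbit representatives in $V(K(\emptyset))$; together they form a finite generating set for $J(\emptyset)$. The generating set for $J(S)$ (resp. $G(S)$) is the image of the chosen generating set for $J(\emptyset)$ (resp. $G(\emptyset)$); $l_{J(S)}$ and $l_{G(S)}$ denote word length with respect to these. Choose a set $E'$ of $G(\emptyset)$-orbit representatives of edges in $K(\emptyset)$ such that each $e\in E'$ is incident on at least one $v\in V'$. For each $u\in V(K(\emptyset))$ let $g_u\in G(\emptyset)$ be the unique element with $g_u\cdot u\in V'$. Define $$N_1:=\max\{\,l(g_u) : u \text{ is incident on some edge in } E'\,\},$$ where $l$ denotes word length in $G(\emptyset)$ with respect to the chosen generating set (with the convention $N_1=0$ if $E'$ is empty). *)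

(* Defs.v *)
From HB Require Import structures.
From mathcomp Require Import all_boot all_order all_algebra.
From mathcomp Require Import mathcomp_extra boolp classical_sets functions.
From mathcomp Require Import cardinality fsbigop.

Set Implicit Arguments.
Unset Strict Implicit.
Unset Printing Implicit Defensive.

Local Open Scope quotient_scope.
Local Open Scope classical_set_scope.
Local Open Scope group_scope.

Notation group_hom := UMagmaMorphism.type.

Section WordLength.
Variable G : groupType.
Implicit Types (X : set G) (g : G).

Definition spelled X g (n : nat) : Prop :=
  exists s : seq G, [/\ forall x, x \in s -> X x \/ X x^-1,
                        \prod_(x <- s) x = g & size s = n].

Definition generates X : Prop := forall g, exists n, spelled X g n.

(* The value is 0 when g is not in the subgroup generated by X. *)
Definition word_length X g : nat :=
  if pselect (exists n, `[< spelled X g n >]) is left ex then ex_minn ex else 0.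

End WordLength.

Definition finitely_generated (G : groupType) : Prop :=
  exists X : set G, finite_set X /\ generates X.

Section Presentation.
Variable I : choiceType.

(* The letter (i, true) stands for i, and (i, false) for its inverse. *)
Notation word := (seq (I * bool)).

Section Group.
Variable R : set word.

Inductive pres_eq : word -> word -> Prop :=
| pres_refl s : pres_eq s s
| pres_sym s t : pres_eq s t -> pres_eq t s
| pres_trans s t u : pres_eq s t -> pres_eq t u -> pres_eq s u
| pres_cancel s t i b : pres_eq (s ++ [:: (i, b); (i, ~~ b)] ++ t) (s ++ t)
| pres_relator s t r : R r -> pres_eq (s ++ r ++ t) (s ++ t).

Definition pres_rel : rel word := fun s t => `[< pres_eq s t >].

Lemma pres_rel_refl : reflexive pres_rel.
Proof. by move=> s; apply/asboolP; exact: pres_refl. Qed.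
Lemma pres_rel_sym : symmetric pres_rel.
Proof.
by move=> s t; apply/asboolP/asboolP; exact: pres_sym.
Qed.
Lemma pres_rel_trans : transitive pres_rel.
Proof.
move=> t s u /asboolP st /asboolP tu; apply/asboolP; exact: pres_trans st tu.
Qed.

Canonical pres_equiv :=
  EquivRel pres_rel pres_rel_refl pres_rel_sym pres_rel_trans.

Definition presented : Type := {eq_quot pres_equiv}.

HB.instance Definition _ := Choice.on presented.
HB.instance Definition _ := Quotient.on presented.
HB.instance Definition _ := EqQuotient.on presented.

Lemma presP s t : (\pi_presented s = \pi_presented t) <-> pres_eq s t.
Proof. by split=> [/eqmodP/asboolP|st]//; apply/eqmodP/asboolP. Qed.

Lemma pres_repr s : pres_eq (repr (\pi_presented s)) s.
Proof. by apply/presP; rewrite reprK. Qed.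

Lemma pres_catl s t u : pres_eq s t -> pres_eq (u ++ s) (u ++ t).
Proof.
move=> st; elim: st u => {s t}.
- by move=> s u; exact: pres_refl.
- by move=> s t _ IH u; apply: pres_sym.
- by move=> s t u _ IH1 _ IH2 x; apply: pres_trans (IH1 x) (IH2 x).
- by move=> s t i b u; rewrite !(catA u); exact: pres_cancel.
- by move=> s t r Rr u; rewrite !(catA u); exact: pres_relator.
Qed.

Lemma pres_catr s t u : pres_eq s t -> pres_eq (s ++ u) (t ++ u).
Proof.
move=> st; elim: st u => {s t}.
- by move=> s u; exact: pres_refl.
- by move=> s t _ IH u; apply: pres_sym.
- by move=> s t u _ IH1 _ IH2 x; apply: pres_trans (IH1 x) (IH2 x).
- by move=> s t i b u; rewrite -!catA; exact: pres_cancel.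
- by move=> s t r Rr u; rewrite -!catA; exact: pres_relator.
Qed.

Lemma pres_cat s s' t t' :
  pres_eq s s' -> pres_eq t t' -> pres_eq (s ++ t) (s' ++ t').
Proof. by move=> ss' /(pres_catl s) h; apply: pres_trans h (pres_catr _ ss'). Qed.

Definition word_inv (s : word) : word := rev [seq (x.1, ~~ x.2) | x <- s].

Lemma word_invK s : word_inv (word_inv s) = s.
Proof.
rewrite /word_inv map_rev revK -map_comp -[RHS]map_id.
by apply: eq_map => -[i b] /=; rewrite negbK.
Qed.

Lemma word_invV s : pres_eq (s ++ word_inv s) [::].
Proof.
elim/last_ind: s => [|s [i b] IH]; first exact: pres_refl.
rewrite /word_inv map_rcons rev_rcons cat_rcons /=.
by apply: pres_trans IH; exact: (pres_cancel s (word_inv s) i b).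
Qed.

Definition pres_mul (x y : presented) : presented := \pi_presented (repr x ++ repr y).
Definition pres_inv (x : presented) : presented := \pi_presented (word_inv (repr x)).
Definition pres_one : presented := \pi_presented [::].

Lemma pres_mulA : associative pres_mul.
Proof.
move=> x y z; apply/presP.
apply: pres_trans (pres_cat (pres_refl _) (pres_repr _)) _.
rewrite catA; apply/pres_sym.
exact: pres_cat (pres_repr _) (pres_refl _).
Qed.

Lemma pres_mul1 : left_id pres_one pres_mul.
Proof.
move=> x; rewrite -[RHS]reprK; apply/presP.
exact: pres_cat (pres_repr [::]) (pres_refl _).
Qed.

Lemma pres_mulr1 : right_id pres_one pres_mul.
Proof.
move=> x; rewrite -[RHS]reprK; apply/presP.
by rewrite -[X in pres_eq _ X]cats0; apply: pres_cat (pres_refl _) (pres_repr [::]).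
Qed.

Lemma pres_mulV : right_inverse pres_one pres_inv pres_mul.
Proof.
move=> x; apply/presP; apply: pres_trans (word_invV (repr x)).
exact: pres_cat (pres_refl _) (pres_repr _).
Qed.

Lemma pres_mulVl : left_inverse pres_one pres_inv pres_mul.
Proof.
move=> x; apply/presP; apply: pres_trans (word_invV (word_inv (repr x))).
by rewrite word_invK; apply: pres_cat (pres_repr _) (pres_refl _).
Qed.

HB.instance Definition _ :=
  isGroup.Build presented pres_mulA pres_mul1 pres_mulr1 pres_mulVl pres_mulV.

Definition pres_gen (i : I) : presented := \pi_presented [:: (i, true)].

Lemma pi_presM s t : \pi_presented (s ++ t) = \pi_presented s * \pi_presented t.
Proof.
by apply/presP; apply/pres_sym/pres_cat; exact: pres_repr.
Qed.

End Group.

Section Lift.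
Variables (R : set word) (H : groupType) (f : I -> H).

Definition word_eval (s : word) : H :=
  \prod_(x <- s) (if x.2 then f x.1 else (f x.1)^-1).

Hypothesis fR : forall r, R r -> word_eval r = 1.

Lemma word_eval_cat s t : word_eval (s ++ t) = word_eval s * word_eval t.
Proof. exact: big_cat. Qed.

Lemma word_eval_eq s t : pres_eq R s t -> word_eval s = word_eval t.
Proof.
elim=> {s t} // [s t u _ -> _ -> // | s t i b | s t r Rr].
- rewrite !word_eval_cat; congr (_ * _); rewrite -[RHS]mul1g; congr (_ * _).
  by rewrite /word_eval !big_cons big_nil mulg1; case: b; rewrite /= ?mulgV ?mulVg.
- by rewrite !word_eval_cat (fR Rr) mul1g.
Qed.

Definition pres_lift (x : presented R) : H := word_eval (repr x).

Lemma pres_lift_pi s : pres_lift (\pi_(presented R) s) = word_eval s.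
Proof. exact/word_eval_eq/pres_repr. Qed.

Lemma pres_lift_gen i : pres_lift (pres_gen R i) = f i.
Proof. by rewrite pres_lift_pi /word_eval big_seq1. Qed.

Lemma pres_liftM : monoid_morphism pres_lift.
Proof.
split=> [|x y]; first by rewrite pres_lift_pi /word_eval big_nil.
by rewrite pres_lift_pi word_eval_cat.
Qed.

HB.instance Definition _ := isUMagmaMorphism.Build _ _ pres_lift pres_liftM.

End Lift.

Lemma pi_pres_eval (R : set word) (s : word) :
  \pi_(presented R) s = word_eval (pres_gen R) s.
Proof.
elim: s => [|[i b] s IH]; first by rewrite /word_eval big_nil.
rewrite -cat1s pi_presM word_eval_cat IH; congr (_ * _).
rewrite /word_eval big_seq1 /=; case: b => //.
apply/(mulgI (pres_gen R i)); rewrite mulgV -pi_presM.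
exact/presP/(@pres_cancel R [::] [::] i true).
Qed.

Lemma word_eval_morph (H H' : groupType) (h : group_hom H H') (f : I -> H) s :
  h (word_eval f s) = word_eval (h \o f) s.
Proof.
rewrite /word_eval gmulf_prod; apply: eq_bigr => -[i b] _ /=.
by case: b => //; rewrite gmulfV.
Qed.

Lemma pres_hom_ext (R : set word) (H : groupType)
    (f g : group_hom (presented R) H) :
  (forall i, f (pres_gen R i) = g (pres_gen R i)) -> f =1 g.
Proof.
move=> fg x; rewrite -[x]reprK pi_pres_eval !word_eval_morph.
by apply: eq_bigr => -[i b] _ /=; rewrite fg.
Qed.

End Presentation.

Record sgraph := SGraph {
  vertex :> choiceType;
  adj : rel vertex;
  adj_sym : symmetric adj;
  adj_irr : irreflexive adj }.

Definition is_edge (K : sgraph) (e : set K) : Prop :=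
  exists u v : K, adj u v /\ e = [set u; v].

(* True in particular when u and v lie in different components. *)
Definition edge_dist_ge (K : sgraph) (n : nat) (u v : K) : Prop :=
  forall p : seq K, path (@adj K) u p -> last u p = v -> (n <= size p)%N.

Record sgraph_hom (K L : sgraph) := SGraphHom {
  sgraph_fun :> K -> L;
  sgraph_homP : forall u v, adj u v -> adj (sgraph_fun u) (sgraph_fun v) }.

Definition racg_relators (K : sgraph) : set (seq (K * bool)) :=
  [set r | (exists v, r = [:: (v, true); (v, true)]) \/
           (exists v w, adj v w /\
              r = [:: (v, true); (w, true); (v, false); (w, false)])].
Arguments racg_relators K : clear implicits.

Definition racg (K : sgraph) : groupType := presented (racg_relators K).

Definition racg_gen (K : sgraph) (v : K) : racg K := pres_gen _ v.

Section RacgMap.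
Variables (K L : sgraph) (f : sgraph_hom K L).

Lemma racg_map_subproof r :
  racg_relators K r -> word_eval (fun v => racg_gen (f v)) r = 1.
Proof.
have -> : word_eval (fun v => racg_gen (f v)) r =
    \pi_(presented (racg_relators L)) [seq (f x.1, x.2) | x <- r].
  by rewrite pi_pres_eval /word_eval big_map.
move=> Rr; apply/presP; rewrite -[map _ _]cats0.
apply: (@pres_relator _ _ [::] [::]).
case: Rr => [[v ->]|[v [w [vw ->]]]]; first by left; exists (f v).
by right; exists (f v), (f w); split=> //; exact: sgraph_homP.
Qed.

Definition racg_map : racg K -> racg L :=
  pres_lift (R := racg_relators K) (fun v => racg_gen (f v)).

HB.instance Definition _ := isUMagmaMorphism.Build (racg K) (racg L) racg_map
  (pres_liftM racg_map_subproof).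

Lemma racg_map_gen v : racg_map (racg_gen v) = racg_gen (f v).
Proof. exact: (pres_lift_gen racg_map_subproof). Qed.

End RacgMap.

Record graph_action (G : groupType) (K : sgraph) := GraphAction {
  act : G -> K -> K;
  act1 : forall u, act 1 u = u;
  actM : forall g h u, act (g * h) u = act g (act h u);
  act_adj : forall g u v, adj (act g u) (act g v) = adj u v }.

Record aut_action (G W : groupType) := AutAction {
  aact : G -> W -> W;
  aact1 : forall x, aact 1 x = x;
  aactM : forall g h x, aact (g * h) x = aact g (aact h x);
  aact_mul : forall g x y, aact g (x * y) = aact g x * aact g y }.

Definition sdprod (G W : groupType) (phi : aut_action G W) : Type :=
  (W * G)%type.

Section Sdprod.
Variables (G W : groupType) (phi : aut_action G W).

HB.instance Definition _ := Choice.copy (sdprod phi) (W * G)%type.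

Definition sd_mul (x y : sdprod phi) : sdprod phi :=
  (x.1 * aact phi x.2 y.1, x.2 * y.2).
Definition sd_one : sdprod phi := (1, 1).
Definition sd_inv (x : sdprod phi) : sdprod phi :=
  (aact phi x.2^-1 x.1^-1, x.2^-1).

Lemma aactg1 g : aact phi g 1 = 1.
Proof. by apply: (mulgI (aact phi g 1)); rewrite -aact_mul !mulg1. Qed.

Lemma sd_mulA : associative sd_mul.
Proof.
by move=> [x g] [y h] [z k]; rewrite /sd_mul /= aact_mul aactM !mulgA.
Qed.
Lemma sd_mul1 : left_id sd_one sd_mul.
Proof. by move=> [x g]; rewrite /sd_mul /= aact1 !mul1g. Qed.
Lemma sd_mulr1 : right_id sd_one sd_mul.
Proof. by move=> [x g]; rewrite /sd_mul /= aactg1 !mulg1. Qed.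
Lemma sd_mulVl : left_inverse sd_one sd_inv sd_mul.
Proof.
by move=> [x g]; rewrite /sd_mul /= -aact_mul !mulVg aactg1.
Qed.
Lemma sd_mulV : right_inverse sd_one sd_inv sd_mul.
Proof.
by move=> [x g]; rewrite /sd_mul /= -aactM !mulgV aact1 mulgV.
Qed.

HB.instance Definition _ :=
  isGroup.Build (sdprod phi) sd_mulA sd_mul1 sd_mulr1 sd_mulVl sd_mulV.

End Sdprod.

Section RacgAction.
Variables (G : groupType) (K : sgraph) (a : graph_action G K).

Lemma act_hom_subproof g u v : adj u v -> adj (act a g u) (act a g v).
Proof. by rewrite act_adj. Qed.

Definition act_hom (g : G) : sgraph_hom K K := SGraphHom (@act_hom_subproof g).

Lemma racg_act1 (x : racg K) : racg_map (act_hom 1) x = x.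
Proof.
apply: (pres_hom_ext (f := racg_map (act_hom 1)) (g := idfun)) => v /=.
by rewrite (racg_map_gen (act_hom 1)) /= act1.
Qed.

Lemma racg_actM g h (x : racg K) :
  racg_map (act_hom (g * h)) x = racg_map (act_hom g) (racg_map (act_hom h) x).
Proof.
apply: (pres_hom_ext (f := racg_map (act_hom (g * h)))
  (g := racg_map (act_hom g) \o racg_map (act_hom h))) => v /=.
by rewrite !(racg_map_gen, racg_map_gen (act_hom _)) /= actM.
Qed.

Lemma racg_act_mul g (x y : racg K) :
  racg_map (act_hom g) (x * y) =
  racg_map (act_hom g) x * racg_map (act_hom g) y.
Proof. exact: gmulfM. Qed.

Definition racg_action : aut_action G (racg K) :=
  @AutAction G (racg K) (fun g => racg_map (act_hom g)) racg_act1 racg_actM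
    racg_act_mul.

(* A free action must also have trivial edge stabilisers; this follows from
   separated_orbits below, which excludes inversions of edges. *)
Definition free_action : Prop := forall g u, act a g u = u -> g = 1.

Definition same_orbit (u v : K) : Prop := exists g, v = act a g u.

Definition same_edge_orbit (e f : set K) : Prop :=
  exists g, f = act a g @` e.

Definition cocompact_action : Prop :=
  finite_set [set same_orbit u | u in [set: K]] /\
  finite_set [set same_edge_orbit e | e in @is_edge K].

Definition separated_orbits (n : nat) : Prop :=
  forall u v, same_orbit u v -> u <> v -> edge_dist_ge n u v.

Definition vertex_representatives (V' : set K) : Prop :=
  forall u, exists! v, V' v /\ same_orbit u v.

Definition edge_representatives (E' : set (set K)) : Prop :=
  E' `<=` @is_edge K /\
  forall e, is_edge e -> exists! f, E' f /\ same_edge_orbit e f.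

(* When the action is free and V' is a set of orbit representatives, this is
   the unique g with g u \in V'. *)
Definition to_representative (V' : set K) (u : K) : G :=
  xget 1 [set g | V' (act a g u)].

(* For a cocompact action, E' being a set of edge orbit representatives, the
   range of the maximum is finite. *)
Definition N1 (A : set G) (V' : set K) (E' : set (set K)) : nat :=
  \big[maxn/0%N]_(u \in [set u | exists2 e, E' e & e u])
    word_length A (to_representative V' u).

End RacgAction.

Section QuotientGraph.
Variables (G : groupType) (K : sgraph) (a : graph_action G K).
Hypothesis sep : separated_orbits a 4.

Section Graph.
Variables (H : groupType) (f : group_hom G H).

Definition ker_orbit : rel K :=
  fun u v => `[< exists2 g, f g = 1 & v = act a g u >].

Lemma ker_orbit_refl : reflexive ker_orbit.
Proof. by move=> u; apply/asboolP; exists 1; rewrite ?gmulf1 ?act1. Qed.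
Lemma ker_orbit_sym : symmetric ker_orbit.
Proof.
suff h u v : ker_orbit u v -> ker_orbit v u by move=> u v; apply/idP/idP; exact: h.
move=> /asboolP[g fg ->]; apply/asboolP; exists g^-1.
  by rewrite gmulfV fg invg1.
by rewrite -actM mulVg act1.
Qed.
Lemma ker_orbit_trans : transitive ker_orbit.
Proof.
move=> v u w /asboolP[g fg ->] /asboolP[h fh ->]; apply/asboolP; exists (h * g).
  by rewrite gmulfM fg fh mulg1.
by rewrite actM.
Qed.

Canonical ker_orbit_equiv :=
  EquivRel ker_orbit ker_orbit_refl ker_orbit_sym ker_orbit_trans.

Definition qvertex : Type := {eq_quot ker_orbit_equiv}.
HB.instance Definition _ := Choice.on qvertex.
HB.instance Definition _ := Quotient.on qvertex.
HB.instance Definition _ := EqQuotient.on qvertex.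

Lemma qvertexP u v :
  \pi_qvertex u = \pi_qvertex v <-> exists2 g, f g = 1 & v = act a g u.
Proof. by split=> [/eqmodP/asboolP|uv]//; apply/eqmodP/asboolP. Qed.

(* Since orbits are separated, the quotient has neither loops nor multiple
   edges, so that it is determined by this adjacency relation. *)
Definition qadj : rel qvertex := fun x y =>
  `[< exists u v, [/\ x = \pi_qvertex u, y = \pi_qvertex v & adj u v] >].

Lemma qadj_sym : symmetric qadj.
Proof.
by move=> x y; apply/asboolP/asboolP => -[u [v [-> -> uv]]]; exists v, u;
  split=> //; rewrite adj_sym.
Qed.

Lemma qadj_irr : irreflexive qadj.
Proof.
move=> x; apply/negP => /asboolP[u [v [-> /qvertexP[g _ vgu] uv]]].
suff : (4 <= size [:: v])%N by [].
apply: (@sep u v) => /=; rewrite ?uv//; first by exists g.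
by move=> uveq; rewrite uveq adj_irr in uv.
Qed.

Definition qgraph : sgraph := SGraph qadj_sym qadj_irr.

Definition qproj (u : K) : qgraph := \pi_qvertex u.

Hypothesis fsurj : forall h, exists g, f g = h.

Definition qact (h : H) (x : qgraph) : qgraph :=
  qproj (act a (sval (cid (fsurj h))) (repr (x : qvertex))).

Lemma qactE g u : qact (f g) (qproj u) = qproj (act a g u).
Proof.
rewrite /qact; case: cid => g' /= fg'.
have /qvertexP[k fk ->] : \pi_qvertex u = \pi_qvertex (repr (qproj u : qvertex)).
  by rewrite reprK.
apply/esym/qvertexP; exists (g' * k * g^-1).
  by rewrite !gmulfM gmulfV fk fg' mulg1 mulgV.
by rewrite -!actM -!mulgA mulVg mulg1.
Qed.

Lemma qprojP (x : qgraph) : exists u, x = qproj u.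
Proof. by exists (repr (x : qvertex)); rewrite /qproj reprK. Qed.

Lemma qact1 x : qact 1 x = x.
Proof. by have [u ->] := qprojP x; rewrite -(gmulf1 (s := f)) qactE act1. Qed.

Lemma qactM h k x : qact (h * k) x = qact h (qact k x).
Proof.
have [u ->] := qprojP x; have [g <-] := fsurj h; have [g' <-] := fsurj k.
by rewrite -gmulfM !qactE actM.
Qed.

Lemma qact_adj h x y : adj (qact h x) (qact h y) = adj x y.
Proof.
suff imp k z t : adj z t -> adj (qact k z) (qact k t).
  by apply/idP/idP => [/(imp h^-1)|]; [rewrite -!qactM mulVg !qact1|exact: imp].
move=> /asboolP[u [v [-> -> uv]]]; have [g <-] := fsurj k.
apply/asboolP; exists (act a g u), (act a g v).
by rewrite act_adj; split=> //; exact: qactE.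
Qed.

Definition qaction : graph_action H qgraph := GraphAction qact1 qactM qact_adj.

End Graph.

Section Map.
Variables (H H' : groupType) (f : group_hom G H) (f' : group_hom G H').
Hypothesis ker_sub : forall g, f g = 1 -> f' g = 1.

Definition qgraph_map_fun (x : qgraph f) : qgraph f' :=
  qproj f' (repr (x : qvertex f)).

Lemma qgraph_mapE u : qgraph_map_fun (qproj f u) = qproj f' u.
Proof.
apply/esym/qvertexP.
have /qvertexP[g fg ->] :
    \pi_(qvertex f) u = \pi_(qvertex f) (repr (qproj f u : qvertex f)).
  by rewrite reprK.
by exists g => //; exact: ker_sub.
Qed.

Lemma qgraph_map_adj x y :
  adj x y -> adj (qgraph_map_fun x) (qgraph_map_fun y).
Proof.
move=> /asboolP[u [v [-> -> uv]]]; apply/asboolP; exists u, v.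
by split=> //; exact: qgraph_mapE.
Qed.

Definition qgraph_map : sgraph_hom (qgraph f) (qgraph f') :=
  SGraphHom qgraph_map_adj.

End Map.

End QuotientGraph.

Record subset_functor := SubsetFunctor {
  fobj :> set int -> groupType;
  fobj_fg : forall S, finitely_generated (fobj S);
  fmap : forall S T, S `<=` T -> group_hom (fobj S) (fobj T);
  fmap_id : forall S (h : S `<=` S) x, fmap h x = x;
  fmap_comp : forall S T U (hST : S `<=` T) (hTU : T `<=` U) (hSU : S `<=` U) x,
    fmap hSU x = fmap hTU (fmap hST x);
  fmap_surj : forall S T (h : S `<=` T) y, exists x, fmap h x = y }.

Section JFunctor.
Variables (G : subset_functor) (K : sgraph) (a : graph_action (G set0) K).
Hypothesis sep : separated_orbits a 4.

Definition from_empty (S : set int) : group_hom (G set0) (G S) :=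
  fmap G (@sub0set _ S).

Definition KS (S : set int) : sgraph := qgraph sep (from_empty S).

Definition KS_action (S : set int) : graph_action (G S) (KS S) :=
  qaction sep (fmap_surj (@sub0set _ S)).

Definition J (S : set int) : groupType := sdprod (racg_action (KS_action S)).

Section Map.
Variables (S T : set int) (hST : S `<=` T).

Lemma KS_map_subproof g : from_empty S g = 1 -> from_empty T g = 1.
Proof.
by move=> fg; rewrite /from_empty (fmap_comp (@sub0set _ S) hST) fg gmulf1.
Qed.

Definition KS_map : sgraph_hom (KS S) (KS T) := qgraph_map sep KS_map_subproof.

Lemma KS_map_equivariant (g : G S) (x : KS S) :
  KS_map (act (KS_action S) g x) = act (KS_action T) (fmap G hST g) (KS_map x).
Proof.
have [u ->] := qprojP x; have [k <-] := fmap_surj (@sub0set _ S) g.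
rewrite -(fmap_comp (@sub0set _ S) hST (@sub0set _ T)) /= qactE.
by rewrite !(qgraph_mapE sep KS_map_subproof) qactE.
Qed.

Definition J_map_fun (x : J S) : J T := (racg_map KS_map x.1, fmap G hST x.2).

Lemma J_map_racg (g : G S) (x : racg (KS S)) :
  racg_map KS_map (aact (racg_action (KS_action S)) g x) =
  aact (racg_action (KS_action T)) (fmap G hST g) (racg_map KS_map x).
Proof.
apply: (pres_hom_ext
  (f := racg_map KS_map \o racg_map (act_hom (KS_action S) g))
  (g := racg_map (act_hom (KS_action T) (fmap G hST g)) \o racg_map KS_map)).
move=> v; rewrite /= -/(racg_gen v) !racg_map_gen.
exact: (congr1 (racg_gen (K := KS T)) (KS_map_equivariant g v)).
Qed.

Lemma J_map_morphism : monoid_morphism J_map_fun.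
Proof.
split=> [|[x g] [y h]]; first by rewrite /J_map_fun /= !gmulf1.
congr (_, _); last exact: gmulfM.
rewrite /= gmulfM; congr (_ * _); exact: J_map_racg.
Qed.

HB.instance Definition _ :=
  isUMagmaMorphism.Build (J S) (J T) J_map_fun J_map_morphism.

Definition J_map : group_hom (J S) (J T) := J_map_fun.

End Map.

Section Generators.
Variables (A : set (G set0)) (V' : set K).

Definition G_gens (S : set int) : set (G S) := from_empty S @` A.

(* The vertices of K(emptyset) = KS set0 are the classes of the vertices of K
   modulo the trivial subgroup. *)
Definition J_gens0 : set (J set0) :=
  [set ((1, g) : J set0) | g in A] `|`
  [set ((racg_gen (qproj sep (from_empty set0) v), 1) : J set0) | v in V'].

Definition J_gens (S : set int) : set (J S) := J_map (@sub0set _ S) @` J_gens0.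

End Generators.

End JFunctor.

Arguments J_gens {G K a} sep A V' S _.
Arguments G_gens {G} A S _.

(* Main.v *)
(** Only w = (x, 1) needs an argument, since the projection to G(S) does not
    increase word length. Spelling w in n letters and writing h_i in G(S) for
    the product of the first i of them, x becomes a product of vertices
    h_i v_i of K(S) with v_i in V', and its image in W_K(T) is trivial. By the
    word problem for right-angled Coxeter groups, the image word cancels by
    deleting pairs of equal letters commuting with all letters in between. If
    every such cancellation lifted to K(S), x would be trivial. So either
    h_i v_i and h_j v_j are distinct but agree in K(T), and then h_i^-1 h_j is
    the element sought; or h_i v_i = h_j v_j and, for some i < m < j, the
    vertices h_i v_i and h_m v_m are adjacent in K(T) but not in K(S). In the
    latter case, lifting the edge to K and translating it to E' gives c with
    l(c) <= N1 such that h_i^-1 h_m c is in the kernel. As h_i = h_j, one of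
    the two arcs of the loop from i to j through m has length at most n/2, so
    that element has length at most n/2 + N1 <= n. *)

Require Import Defs.
From HB Require Import structures.
From mathcomp Require Import all_boot all_order all_algebra.
From mathcomp Require Import mathcomp_extra boolp classical_sets functions.
From mathcomp Require Import cardinality fsbigop.
From mathcomp Require Import zify.

Local Open Scope classical_set_scope.
Local Open Scope group_scope.
Set Implicit Arguments.
Unset Strict Implicit.
Unset Printing Implicit Defensive.

(** * Involutions and commutations in right-angled Coxeter groups *)

Lemma racg_gen2 (L : sgraph) (v : L) : racg_gen v * racg_gen v = 1.
Proof.
rewrite -pi_presM; apply/presP.
by apply: (@pres_relator _ _ [::] [::] [:: (v, true); (v, true)]); left; exists v.
Qed.

Lemma racg_genV (L : sgraph) (v : L) : (racg_gen v)^-1 = racg_gen v.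
Proof. by apply: (mulgI (racg_gen v)); rewrite mulgV racg_gen2. Qed.

Lemma racg_gen_comm (L : sgraph) (v w : L) : adj v w ->
  racg_gen v * racg_gen w = racg_gen w * racg_gen v.
Proof.
move=> vw; apply: (mulIg (racg_gen v)^-1); apply: (mulIg (racg_gen w)^-1).
rewrite mulgK mulgV.
pose r := [:: (v, true); (w, true); (v, false); (w, false)].
have /presP : pres_eq (racg_relators L) r [::].
  apply: (@pres_relator _ _ [::] [::] r).
  by right; exists v, w.
by rewrite !pi_pres_eval /word_eval !big_cons !big_nil /= mulg1 !mulgA.
Qed.

(** * The word problem for right-angled Coxeter groups *)

Section Reduction.
Variable L : sgraph.
Implicit Types (a b v w x : L) (s t p q : seq L).

(** Says that commutations bring the first [v] of [s] to the front; as [adj] is irreflexive, no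
    later occurrence can pass the first. *)
Definition movable v s :=
  (v \in s) && all (@adj L v) (take (index v s) s).

(* On reduced words up to commutation, [push v] is left multiplication by v;
   that it defines an action of the Coxeter group solves the word problem. *)
Definition push v s := if movable v s then rem v s else v :: s.

Definition reduction s : seq L := foldr push [::] s.

Fixpoint reduced s :=
  if s is v :: s' then ~~ movable v s' && reduced s' else true.

(* Projections to pairs of non-commuting letters determine an element of a
   trace monoid. *)
Definition trace_eq s t :=
  forall a b, ~~ adj a b -> filter (pred2 a b) s = filter (pred2 a b) t.

Lemma trace_eq_trans s t p : trace_eq s t -> trace_eq t p -> trace_eq s p.
Proof. by move=> st tp a b ab; rewrite st// tp. Qed.

Lemma trace_eq_nil s : trace_eq s [::] -> s = [::].
Proof.
case: s => // v s /(_ v v); rewrite adj_irr => /(_ isT) /=.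
by rewrite eqxx.
Qed.

Lemma adj_neq v w : adj v w -> v != w.
Proof. by apply: contraTneq => ->; rewrite adj_irr. Qed.

Lemma movable_cons v x s :
  movable v (x :: s) = (v == x) || adj v x && movable v s.
Proof.
rewrite /movable inE /= [x == v]eq_sym; case: (v == x) => //=.
by rewrite andbCA.
Qed.

Lemma movable_cat v p q : all (@adj L v) p -> movable v (p ++ q) = movable v q.
Proof.
elim: p => //= x p IH /andP[vx vp]; rewrite movable_cons vx IH//.
by rewrite (negbTE (adj_neq vx)).
Qed.

Lemma movableP v s : reflect
  (exists p q, [/\ s = p ++ v :: q, all (@adj L v) p & rem v s = p ++ q])
  (movable v s).
Proof.
apply: (iffP idP) => [|[p [q [-> vp _]]]]; last first.
  by rewrite movable_cat// movable_cons eqxx.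
elim: s => // x s IH; rewrite movable_cons.
have [<- _|vx /= /andP[avx /IH[p [q [-> vp rE]]]]] := eqVneq v x.
  by exists [::], s; split=> //=; rewrite eqxx.
by exists (x :: p), q; split=> //=; rewrite ?avx// eq_sym (negbTE vx) rE.
Qed.

Lemma movable_rem v w s : adj v w -> movable v (rem w s) = movable v s.
Proof.
move=> vw; elim: s => //= x s IH; have [->|xw] := eqVneq x w.
  by rewrite movable_cons vw (negbTE (adj_neq vw)).
by rewrite !movable_cons IH.
Qed.

(** Putting [v] back does not block an earlier letter [x] adjacent to [v], so [x] would have been
    movable before the removal too. *)
Lemma reduced_rem v s : movable v s -> reduced s -> reduced (rem v s).
Proof.
move=> /movableP[p [q [-> vp ->]]]; elim: p vp => [_ /andP[]//|x p IH] /=.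
move=> /andP[vx vp] /andP[xpq /(IH vp) ->]; rewrite andbT.
apply: contra xpq; elim: p {IH vp} => [|y p IH] /=.
  by rewrite movable_cons adj_sym vx => ->; rewrite orbT.
by rewrite !movable_cons => /orP[->//|/andP[-> /IH ->]]; rewrite orbT.
Qed.

Lemma reduced_push v s : reduced s -> reduced (push v s).
Proof.
rewrite /push; case: ifPn => [vs|vs /= ->]; first exact: reduced_rem.
by rewrite vs.
Qed.

Lemma reduced_reduction s : reduced (reduction s).
Proof. by elim: s => //= v s; exact: reduced_push. Qed.

Lemma filter_rem v (P : pred L) s : filter P (rem v s) = rem v (filter P s).
Proof.
elim: s => //= x s IH; have [->|xv] := eqVneq x v.
  by case: ifPn => Pv /=; rewrite ?eqxx// rem_id// mem_filter (negbTE Pv).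
by rewrite /= IH; case: ifPn => //= _; rewrite (negbTE xv).
Qed.

(** Reads movability off the projections to non-commuting pairs, hence makes it invariant under
    [trace_eq]. The case [b = v] makes [v] occur in [s]. *)
Lemma movable_trace v s : movable v s <->
  forall b, ~~ adj v b -> ohead (filter (pred2 v b) s) = Some v.
Proof.
split=> [/movableP[p [q [-> vp _]]] b vb|].
  rewrite filter_cat -[X in X ++ _](_ : [::] = _) /= ?eqxx//.
  apply/esym/eqP; rewrite -[_ == _]negbK -has_filter; apply/hasPn => x xp.
  have vx := allP vp _ xp; rewrite /= negb_or eq_sym (adj_neq vx) /=.
  by apply: contraNneq vb => <-.
elim: s => [/(_ v)|x s IH vs]; first by rewrite adj_irr => /(_ isT).
rewrite movable_cons; have [//|vx /=] := eqVneq v x.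
have avx : adj v x.
  apply/negPn/negP => /vs /=; rewrite eqxx orbT /= => -[xv].
  by rewrite xv eqxx in vx.
rewrite avx; apply: IH => b vb; rewrite -(vs b vb) /=.
rewrite eq_sym (negbTE vx) /=; case: eqP => // xb.
by rewrite -xb avx in vb.
Qed.

Lemma push_trace v s t : trace_eq s t -> trace_eq (push v s) (push v t).
Proof.
move=> st; have -> : push v s = if movable v t then rem v s else v :: s.
  rewrite /push; congr (if _ then _ else _).
  by apply/idP/idP => /movable_trace vs; apply/movable_trace => b vb;
    rewrite -(vs b vb) st.
by rewrite /push; case: ifP => _ a b ab; rewrite ?filter_rem /= st.
Qed.

Lemma foldr_push_trace p s t :
  trace_eq s t -> trace_eq (foldr push s p) (foldr push t p).
Proof. by move=> st; elim: p => //= v p; exact: push_trace. Qed.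

(** If [v] cancels in [s = p ++ v :: q], the second push puts it back in front of [p], whose letters
    commute with it; [reduced s] excludes a further cancellation in [q]. *)
Lemma pushK v s : reduced s -> trace_eq (push v (push v s)) s.
Proof.
move=> rs; rewrite {2}/push; case: ifPn => [/movableP[p [q [sE vp ->]]]|vs].
  have -> : push v (p ++ q) = v :: p ++ q.
    suff nvq : ~~ movable v q by rewrite /push movable_cat// (negbTE nvq).
    by move: rs; rewrite sE; elim: p {sE vp} => [/andP[]|x p IH /andP[_ /IH]].
  move=> a b ab; rewrite sE /= !filter_cat /=; case: ifPn => // vab.
  suff -> : filter (pred2 a b) p = [::] by [].
  apply/eqP; rewrite -[_ == _]negbK -has_filter; apply/hasPn => x xp.
  have vx := allP vp _ xp; have := adj_neq vx => nvx.
  apply: contra ab => /= /orP[] /eqP xE; subst x;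
    move: vab; rewrite /= ?(negbTE nvx) ?orbF => /eqP <- //.
  by rewrite adj_sym.
by rewrite /push movable_cons eqxx /= eqxx.
Qed.

Lemma rem_comm v w s : rem v (rem w s) = rem w (rem v s).
Proof.
have [-> //|vw] := eqVneq v w; elim: s => //= x s IH.
have [->|xv] := eqVneq x v; first by rewrite (negbTE vw) /= eqxx.
have [->|xw] /= := eqVneq x w; first by rewrite eqxx.
by rewrite (negbTE xv) (negbTE xw) IH.
Qed.

Lemma push_comm v w s : adj v w -> trace_eq (push v (push w s)) (push w (push v s)).
Proof.
move=> vw; have nvw := adj_neq vw; have wv : adj w v by rewrite adj_sym.
have mv r : movable v (w :: r) = movable v r.
  by rewrite movable_cons vw (negbTE nvw).
have mw r : movable w (v :: r) = movable w r.
  by rewrite movable_cons wv eq_sym (negbTE nvw).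
rewrite /push; case: (boolP (movable w s)) => mws;
  case: (boolP (movable v s)) => mvs;
  rewrite ?mv ?mw ?movable_rem ?mvs ?mws ?(negbTE mvs) ?(negbTE mws) //=.
- by rewrite rem_comm.
- by rewrite (negbTE nvw).
- by rewrite eq_sym (negbTE nvw).
move=> a b ab /=; case: ifPn => [/orP[]/eqP vE|//];
  case: ifPn => // /orP[] /eqP wE; subst.
- by rewrite eqxx in nvw.
- by rewrite vw in ab.
- by rewrite wv in ab.
- by rewrite eqxx in nvw.
Qed.

(** Generators are involutions, so [map fst] may forget signs; a cancelling pair and a square then
    both fall under [pushK]. *)
Lemma reduction_pres_eq (s t : seq (L * bool)) :
  pres_eq (racg_relators L) s t ->
  trace_eq (reduction (map fst s)) (reduction (map fst t)).
Proof.
elim=> {s t} [s||||] //.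
- by move=> s t _ st a b ab; rewrite st.
- by move=> s t u _ st _; exact: trace_eq_trans.
- move=> s t v b; rewrite !map_cat /reduction !foldr_cat /=.
  by apply: foldr_push_trace; apply: pushK; exact: reduced_reduction.
- move=> s t r Rr; rewrite !map_cat /reduction !foldr_cat.
  apply: foldr_push_trace; have rt := reduced_reduction (map fst t).
  case: Rr => [[v ->]|[v [w [vw ->]]]] /=; first exact: pushK.
  (* The commutator acts as [v w v w]; exchanging the middle letters leaves two squares. *)
  apply: trace_eq_trans (pushK w rt).
  set q := reduction _ in rt *.
  apply: (@trace_eq_trans _ (push v (push v (push w (push w q))))).
    by apply: push_trace; apply: push_comm; rewrite adj_sym.
  by apply: pushK; do 2![apply: reduced_push].
Qed.

Lemma reduction_racg1 s : \prod_(v <- s) racg_gen v = 1 -> reduction s = [::].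
Proof.
move=> s1; apply: trace_eq_nil.
suff /reduction_pres_eq : pres_eq (racg_relators L) [seq (v, true) | v <- s] [::].
  by rewrite -map_comp map_id.
by apply/presP; rewrite !pi_pres_eval /word_eval big_map big_nil.
Qed.

(* The letters of s left on the stack of [reduction (map f s)] have the same
   product under [e] as s, because each cancellation is also valid in H. *)
Lemma prod_reduction (X : eqType) (H : groupType) (f : X -> L) (e : X -> H)
    (s : seq X) :
  (forall x y : X, subseq [:: x; y] s -> f x = f y -> e x * e y = 1) ->
  (forall x z y : X, subseq [:: x; z; y] s -> f x = f y -> adj (f x) (f z) ->
    e x * e z = e z * e x) ->
  reduction (map f s) = [::] -> \prod_(x <- s) e x = 1.
Proof.
move=> He Hc r0.
suff [r [_ rE ->]] : exists r : seq X, [/\ subseq r s,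
    map f r = reduction (map f s) & \prod_(x <- s) e x = \prod_(x <- r) e x].
  by move: rE; rewrite r0; case: r => // _; rewrite big_nil.
elim: s {r0} He Hc => [|x s IH] He Hc; first by exists [::].
have [r [rs rE sE]] : exists r : seq X, [/\ subseq r s,
    map f r = reduction (map f s) & \prod_(x <- s) e x = \prod_(x <- r) e x].
  apply: IH => [y z yz|y t z ytz]; [apply: He|apply: Hc];
    by apply: subseq_trans (subseq_cons s x).
rewrite /= -rE /push big_cons sE; case: ifPn => [|_]; last first.
  exists (x :: r); split=> //; last by rewrite big_cons.
  by rewrite /= eqxx.
move=> /movableP[p [q [fE xp ->]]].
(* The splitting at the cancelled letter is pulled back to [r], where the letter [y] may differ from
   [x]. *)
have [p' [y [q' [pE qE yE rpq]]]] : exists (p' : seq X) (y : X) (q' : seq X),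
    [/\ map f p' = p, map f q' = q, f x = f y & r = p' ++ y :: q'].
  exists (take (size p) r); move: (size_map f r); rewrite fE size_cat /= => sz.
  have := congr1 (drop (size p)) fE; rewrite -map_drop drop_size_cat//.
  case E : (drop (size p) r) => [//|y q'] /= [fy fq]; exists y, q'; split=> //.
    by rewrite map_take fE take_size_cat.
  by rewrite -E cat_take_drop.
have sub_xs (t : seq X) : subseq t r -> subseq (x :: t) (x :: s).
  by move=> tr; rewrite /= eqxx; exact: subseq_trans rs.
exists (p' ++ q'); split; last 1 first.
- have xy : e x * e y = 1.
    apply: He => //; apply: sub_xs.
    by rewrite sub1seq rpq mem_cat inE eqxx orbT.
  have xp' : {in p', forall z, e x * e z = e z * e x}.
    move=> z zp; apply: (Hc x z y) => //.
      apply: sub_xs; rewrite rpq (cat_subseq (s1 := [:: z]) (s2 := [:: y]))//.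
        by rewrite sub1seq.
      by rewrite sub1seq inE eqxx.
    by apply: (allP xp); rewrite -pE map_f.
  have : e x * \prod_(z <- p') e z = \prod_(z <- p') e z * e x.
    elim: p' xp' {pE rpq} => [|z p' IHp] xp'; first by rewrite big_nil mulg1 mul1g.
    rewrite big_cons mulgA xp' ?inE ?eqxx// -mulgA IHp ?mulgA// => t tp.
    by apply: xp'; rewrite inE tp orbT.
  by rewrite rpq !big_cat big_cons /= mulgA => ->; rewrite -mulgA (mulgA (e x)) xy mul1g.
- apply: subseq_trans (subseq_cons s x); apply: subseq_trans rs.
  by rewrite rpq cat_subseq// subseq_cons.
- by rewrite map_cat pE qE.
Qed.

End Reduction.

(** * Spellings and word length *)

Section Spelled.
Variables (G : groupType) (X : set G).

Lemma spelledM g h m n :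
  spelled X g m -> spelled X h n -> spelled X (g * h) (m + n).
Proof.
move=> [s [sX <- <-]] [t [tX <- <-]]; exists (s ++ t); split.
- by move=> x; rewrite mem_cat => /orP[/sX|/tX].
- by rewrite big_cat.
- by rewrite size_cat.
Qed.

Lemma spelledV g n : spelled X g n -> spelled X g^-1 n.
Proof.
move=> [s [sX <- <-]]; exists (rev [seq x^-1 | x <- s]); split.
- by move=> x; rewrite mem_rev => /mapP[y /sX + ->]; rewrite invgK => -[]; [right|left].
- elim: s {sX} => [|x s IH]; first by rewrite !big_nil invg1.
  by rewrite /= rev_cons big_rcons /= IH big_cons invgM.
- by rewrite size_rev size_map.
Qed.

Lemma word_length_le g n : spelled X g n -> (word_length X g <= n)%N.
Proof.
move=> gn; rewrite /word_length; case: pselect => // ex.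
by case: ex_minnP => m _; apply; exact/asboolP.
Qed.

Lemma spelled_word_length g :
  (exists n, spelled X g n) -> spelled X g (word_length X g).
Proof.
move=> [n gn]; rewrite /word_length; case: pselect => [ex|]; last first.
  by case; exists n; exact/asboolP.
by case: ex_minnP => m /asboolP.
Qed.

(** Positive length excludes the default value 0 of elements without a spelling. *)
Lemma word_length_gt0_spelled g :
  (0 < word_length X g)%N -> spelled X g (word_length X g).
Proof.
rewrite /word_length; case: pselect => // ex _.
by case: ex_minnP => m /asboolP.
Qed.

End Spelled.

Lemma spelled_image (G H : groupType) (f : group_hom G H) (X : set G) g n :
  spelled X g n -> spelled (f @` X) (f g) n.
Proof.
move=> [s [sX <- <-]]; exists (map f s); split.
- move=> _ /mapP[x /sX xX ->]; rewrite -gmulfV.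
  by case: xX => xX; [left; exists x|right; exists x^-1].
- by rewrite gmulf_prod big_map.
- by rewrite size_map.
Qed.

Lemma leq_fsbig_maxn (T : choiceType) (A : set T) (F : T -> nat) x :
  finite_set A -> A x -> (F x <= \big[maxn/0%N]_(y \in A) F y)%N.
Proof.
by move=> Afin Ax; rewrite (fsbigD1 x)// leq_maxl.
Qed.

(** * Products in a semidirect product *)

Section Sdprod.
Variables (G W : groupType) (phi : aut_action G W).

(** Each letter is acted on by the [G]-part of the prefix before it; this produces the vertices
    [h_i v_i]. *)
Lemma sdprod_prod1 (s : seq (sdprod phi)) : (\prod_(x <- s) x).1 =
  \prod_(i <- iota 0 (size s))
     aact phi (\prod_(x <- take i s) x).2 (nth 1 s i).1.
Proof.
elim/last_ind: s => [|s x IH]; first by rewrite !big_nil.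
rewrite size_rcons -addn1 iotaD -cats1 !big_cat /= !big_seq1 add0n.
rewrite take_size_cat// nth_cat ltnn subnn /=; congr (_ * _).
rewrite {}IH big_seq [RHS]big_seq; apply: eq_bigr => i.
rewrite mem_iota add0n => /andP[_ ilt].
by rewrite takel_cat 1?ltnW// nth_cat ilt.
Qed.

End Sdprod.

(** * Lifting vertices and edges from the quotient graphs to [K] *)

Section Free.
Variables (G : subset_functor) (K : sgraph) (a : graph_action (G set0) K).
Hypotheses (free : free_action a) (sep : separated_orbits a 4).
Variables (V' : set K) (V'_repr : vertex_representatives a V').

Lemma actVK g u : act a g^-1 (act a g u) = u.
Proof. by rewrite -actM mulVg act1. Qed.

Lemma free_inj g h u : act a g u = act a h u -> g = h.
Proof.
move=> e; apply: (mulgI h^-1); rewrite mulVg; apply: (free (u := u)).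
by rewrite actM e actVK.
Qed.

Lemma representative_eq v v' g : V' v -> V' v' -> v' = act a g v -> v' = v.
Proof.
move=> Vv Vv' e; have [x [_ xu]] := V'_repr v.
rewrite -(xu v'); last by split=> //; exists g.
by apply: xu; split=> //; exists 1; rewrite act1.
Qed.

(** A kernel element [t] carrying [k v] to [k' v'] forces [v = v'], and then freeness gives
    [k' = t k]. *)
Lemma qproj_representative_eq (H : groupType) (f : group_hom (G set0) H)
    k k' v v' : V' v -> V' v' ->
  qproj sep f (act a k v) = qproj sep f (act a k' v') -> v = v' /\ f k = f k'.
Proof.
move=> Vv Vv' /qvertexP[t ft e].
have vv' : v' = v.
  apply: (@representative_eq v v' (k'^-1 * (t * k))) => //.
  by rewrite !actM -e actVK.
subst v'; split=> //; move: e; rewrite -actM => /free_inj ->.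
by rewrite gmulfM ft mul1g.
Qed.

Variables (A : set (G set0)) (A_gen : generates A).
Variables (E' : set (set K)) (E'_repr : edge_representatives a E').
Hypotheses (cocompact : cocompact_action a)
  (E'_V' : forall e, E' e -> exists2 v, V' v & e v).

Lemma to_representativeP u : V' (act a (to_representative a V' u) u).
Proof.
rewrite /to_representative; apply: (@xgetPex _ 1 [set g | V' (act a g u)]).
by have [v [[Vv [g vE]] _]] := V'_repr u; exists g; rewrite /= -vE.
Qed.

(** Choosing an element of [E'] in each edge orbit shows [E'] to lie in the image of a finite
    set. *)
Lemma edge_representatives_finite : finite_set E'.
Proof.
have [_ fin] := cocompact; have [E'sub E'ex] := E'_repr.
pose r (c : set (set K)) := xget set0 (E' `&` c).
apply: sub_finite_set (finite_image r fin) => e E'e.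
exists (same_edge_orbit a e); first by exists e => //; exact: E'sub.
have [f [_ fu]] := E'ex e (E'sub _ E'e).
have ee : same_edge_orbit a e e.
  exists 1; rewrite (_ : act a 1 = idfun) ?image_id//.
  by apply/funext => u; rewrite act1.
rewrite /r; case: xgetP => [g _ [E'g eg]|/(_ e)]; last by case.
by rewrite -(fu e)//; apply/esym/fu.
Qed.

Lemma word_length_to_representative_le e u : E' e -> e u ->
  (word_length A (to_representative a V' u) <= N1 a A V' E')%N.
Proof.
move=> E'e eu.
apply: (leq_fsbig_maxn (fun u => word_length A (to_representative a V' u)));
  last by exists e.
apply: (@sub_finite_set _ _ (\bigcup_(e in E') e)); first by move=> x [d]; exists d.
apply: bigcup_finite; first exact: edge_representatives_finite.
by move=> d /E'_repr.1[x [y [_ ->]]]; exact: finite_set2.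
Qed.

(** Translating an edge over the given one into [E'] puts one endpoint in [V']; up to inversion, [c]
    moves the other there. As [k] and [k' c] have the same image, [k] sends the edge from [v] to
    [c^-1 v'] to an edge over the given one. *)
Lemma adj_qproj_lift (H : groupType) (f : group_hom (G set0) H) k k' v v' :
  V' v -> V' v' ->
  @adj (qgraph sep f) (qproj sep f (act a k v)) (qproj sep f (act a k' v')) ->
  exists c n, [/\ spelled A c n, (n <= N1 a A V' E')%N,
    f (k^-1 * k' * c) = 1 & adj v (act a c^-1 v')].
Proof.
move=> Vv Vv' /asboolP[p [q [pE qE pq]]].
have [e [[E'e [t eE]] _]] := E'_repr.2 [set p; q]
  (ex_intro _ p (ex_intro _ q (conj pq erefl))).
have etp : e (act a t p) by rewrite eE; exists p => //; left.
have etq : e (act a t q) by rewrite eE; exists q => //; right.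
have bound u : e u -> exists n,
    spelled A (to_representative a V' u) n /\ (n <= N1 a A V' E')%N.
  move=> eu; eexists; split; last exact: word_length_to_representative_le eu.
  exact/spelled_word_length/A_gen.
(* The edge orbit representative has an endpoint in V', over one of the two
   vertices; the other endpoint is then moved into V' by a short element. *)
have key (l l' : G set0) x x' y z : V' x -> V' x' ->
    qproj sep f (act a l x) = qproj sep f y ->
    qproj sep f (act a l' x') = qproj sep f z ->
    V' (act a t y) -> e (act a t z) -> adj y z ->
  exists c n, [/\ spelled A c n, (n <= N1 a A V' E')%N,
    f (l^-1 * l' * c) = 1 & adj x (act a c^-1 x')].
  move=> Vx Vx' yE zE Vty etz yz; have [n [cn nN]] := bound _ etz.
  set c := to_representative a V' _ in cn.
  have yE' : qproj sep f (act a l x) =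
      qproj sep f (act a t^-1 (act a t y)) by rewrite actVK.
  have zE' : qproj sep f (act a l' x') =
      qproj sep f (act a (t^-1 * c^-1) (act a c (act a t z))).
    by rewrite actM !actVK.
  have [xE fl] := qproj_representative_eq Vx Vty yE'.
  have [x'E fl'] := qproj_representative_eq Vx' (to_representativeP _) zE'.
  exists c, n; split=> //.
    by rewrite !gmulfM gmulfV fl fl' -gmulfV -!gmulfM invgK mulVKg mulVg gmulf1.
  by rewrite xE x'E actVK act_adj.
have [x Vx ex] := E'_V' E'e; move: ex; rewrite eE => -[_ [->|->]] xE; subst x.
  exact: key pE qE Vx etq pq.
(* Here the endpoint in [V'] lies over the second vertex, so the roles are exchanged and the element
   found is inverted. *)
have qp : adj q p by rewrite adj_sym.
have [c [n [cn nN fc adjc]]] := key _ _ _ _ _ _ Vv' Vv qE pE Vx etp qp.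
exists c^-1, n; split=> //; first exact: spelledV.
- have {}fc : f (k'^-1 * k) = f c^-1.
    by apply: (mulIg (f c)); rewrite -!gmulfM mulVg gmulf1.
  by rewrite gmulfM -fc -gmulfM mulgA mulgK mulVg gmulf1.
- by rewrite invgK adj_sym -(act_adj a c^-1) actVK.
Qed.

End Free.

(** * Letters of [J(S)] and their projection to [G(S)] *)

Section JLetters.
Variables (G : subset_functor) (K : sgraph) (a : graph_action (G set0) K).
Hypothesis sep : separated_orbits a 4.
Variables (A : set (G set0)) (V' : set K) (S : set int).
Implicit Type x : J sep S.

Definition vertex_letter (v : K) : J sep S :=
  (racg_gen (qproj sep (from_empty G S) v), 1).

Definition group_letter x : Prop :=
  x.1 = 1 /\ (G_gens A S x.2 \/ G_gens A S x.2^-1).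

Lemma sdprod_fst_inv1 x : x.1 = 1 -> x^-1.1 = 1.
Proof.
case: x => y g /= ->.
rewrite -[LHS]/(aact (racg_action (KS_action sep S)) g^-1 1^-1).
by rewrite invg1 aactg1.
Qed.

Lemma vertex_letterV v : (vertex_letter v)^-1 = vertex_letter v.
Proof.
rewrite -[LHS]/(aact (racg_action (KS_action sep S)) 1^-1 _^-1, 1^-1).
by rewrite invg1 aact1 racg_genV.
Qed.

Lemma J_gens_letter x : J_gens sep A V' S x \/ J_gens sep A V' S x^-1 ->
  group_letter x \/ exists2 v, V' v & x = vertex_letter v.
Proof.
have gens y : J_gens sep A V' S y -> (y.1 = 1 /\ G_gens A S y.2) \/
    exists2 v, V' v & y = vertex_letter v.
  move=> [_ [[g Ag <-]|[v Vv <-]] <-].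
    by left; split; [exact: gmulf1|exists g].
  right; exists v => //; rewrite /vertex_letter /J_map /= /J_map_fun /=.
  congr (_, _); last exact: gmulf1.
  rewrite racg_map_gen; congr (racg_gen _).
  exact: (qgraph_mapE sep (@KS_map_subproof _ _ _ (@sub0set _ S))).

move=> [/gens[[x1 x2]|]|/gens[[x1 x2]|[v Vv xE]]].
- by left; split=> //; left.
- by right.
- by left; split; [rewrite -[x]invgK; exact: sdprod_fst_inv1|right].
- by right; exists v => //; rewrite -[x]invgK xE vertex_letterV.
Qed.

Lemma sdprod_prod2 (s : seq (J sep S)) :
  (\prod_(x <- s) x).2 = \prod_(x <- s) x.2.
Proof.
by elim: s => [|x s IH]; rewrite ?big_nil// !big_cons -IH.
Qed.

Lemma spelled_prod2 (s : seq (J sep S)) :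
  (forall x, x \in s -> group_letter x \/ exists2 v, V' v & x = vertex_letter v) ->
  exists2 n, (n <= size s)%N & spelled (G_gens A S) (\prod_(x <- s) x).2 n.
Proof.
rewrite sdprod_prod2; elim: s => [|x s IH] sX.
  by exists 0; rewrite // big_nil; exists [::]; split; rewrite // big_nil.
have [|n ns sn] := IH; first by move=> y ys; apply: sX; rewrite inE ys orbT.
rewrite big_cons; have [[_ xA]|[v _ ->]] := sX x (mem_head _ _).
  exists n.+1; rewrite // -add1n; apply: spelledM sn.
  by exists [:: x.2]; split=> // [y|]; rewrite ?big_seq1// inE => /eqP ->.
by exists n; [exact: leqW|rewrite mul1g].
Qed.

End JLetters.

(** * Short elements in the kernel of [G(S) -> G(T)] *)

Theorem theorem6p2 (G : subset_functor) (K : sgraph)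
    (a : graph_action (G set0) K)
    (free : free_action a) (cocompact : cocompact_action a)
    (sep : separated_orbits a 4)
    (A : set (G set0)) (A_finite : finite_set A) (A_gen : generates A)
    (V' : set K) (V'_repr : vertex_representatives a V')
    (E' : set (set K)) (E'_repr : edge_representatives a E')
    (E'_V' : forall e, E' e -> exists2 v, V' v & e v)
    (S T : set int) (hST : S `<=` T) (w : J sep S) :
  J_map sep hST w = 1 ->
  (2 * N1 a A V' E' < word_length (J_gens sep A V' S) w)%N ->
  exists g : G S,
    [/\ g <> 1,
        (word_length (G_gens A S) g <= word_length (J_gens sep A V' S) w)%N
      & fmap G hST g = 1].
Proof.
move=> w1 lw; have [s [sX sE sn]] := 
  word_length_gt0_spelled (leq_ltn_trans (leq0n _) lw).
move: lw; set n := word_length _ w in sn * => lw.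
apply: contrapT => no.
(* By contradiction, a kernel element spelled with at most [n] letters is trivial. *)
have triv g m : spelled (G_gens A S) g m -> (m <= n)%N -> fmap G hST g = 1 ->
    g = 1.
  move=> gm mn g1; apply: contrapT => gn1; apply: no; exists g; split=> //.
  exact: leq_trans (word_length_le gm) mn.
have sL x : x \in s -> group_letter A x \/
    exists2 v, V' v & x = vertex_letter sep S v.
  by move=> /sX /J_gens_letter.
have w21 : w.2 = 1.
  have [m mn wm] := spelled_prod2 sL; rewrite sE in wm.
  apply: triv wm _ (congr1 snd w1); by rewrite -sn.
suff w11 : w.1 = 1.
  have wE : w = 1 by rewrite [w]surjective_pairing w11 w21.
  suff /word_length_le : spelled (J_gens sep A V' S) w 0.
    by rewrite -/n leqn0 => /eqP n0; rewrite n0 in lw.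
  by exists [::]; rewrite big_nil wE; split.
pose h i : G S := (\prod_(x <- take i s) x).2.
have hdist i j : (i <= j)%N -> exists2 m, (m <= j - i)%N &
    spelled (G_gens A S) ((h i)^-1 * h j) m.
  move=> ij; pose t := drop i (take j s).
  have hj : h j = h i * (\prod_(x <- t) x).2.
    by rewrite /h -[take j s](cat_take_drop i) big_cat take_takel.
  have [|m mt tm] := @spelled_prod2 _ _ _ sep A V' S t.
    by move=> x /mem_drop/mem_take; exact: sL.
  exists m; last by rewrite hj mulKg.
  apply: leq_trans mt _; rewrite size_drop leq_sub2r// size_take_min.
  exact: geq_minl.
pose isV i := `[< exists v, V' v /\ nth 1 s i = vertex_letter sep S v >].
pose e i : racg (KS sep S) :=
  aact (racg_action (KS_action sep S)) (h i) (nth 1 s i).1.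
(* Positions are kept instead of vertices, so that the prefixes [h i] and the distances [j - i]
   remain available. *)
pose l := filter isV (iota 0 n).
have wl : w.1 = \prod_(i <- l) e i.
  rewrite -sE sdprod_prod1 sn big_filter [RHS]big_rmcond_in // => i.
  rewrite mem_iota add0n -sn => /andP[_ ilt] niV.
  have [[i1 _]|[v Vv iE]] := sL _ (mem_nth 1 ilt); first by rewrite /e i1 aactg1.
  by case/negP: niV; apply/asboolP; exists v.
(* [v0] serves as default at positions of group letters; if [K] has no vertex, [l] is empty. *)
have [[v0 _]|noV] := pselect (exists v : K, True); last first.
  rewrite wl /l (eq_filter (a2 := pred0)) ?filter_pred0 ?big_nil// => i.
  by apply/negP => /asboolP[v _]; apply: noV; exists v.
have /choice[v vP] i : exists v, isV i ->
    V' v /\ nth 1 s i = vertex_letter sep S v.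
  by case: (boolP (isV i)) => [/asboolP[v vP]|_]; [exists v|exists v0].
have /choice[k kP] i : exists k, from_empty G S k = h i by exact: fmap_surj.
(* Lifting [h i] to [k i] presents [h_i v_i] in [K(S)] and its image in [K(T)] as projections of one
   vertex of [K]. *)
pose u i : KS sep S := qproj sep (from_empty G S) (act a (k i) (v i)).
pose f i : KS sep T := qproj sep (from_empty G T) (act a (k i) (v i)).
have fT g : from_empty G T g = fmap G hST (from_empty G S g) by exact: fmap_comp.
have lP i : i \in l -> [/\ isV i, (i < n)%N & e i = racg_gen (u i)].
  rewrite mem_filter mem_iota add0n /= => /andP[iV ilt]; split=> //.
  rewrite /e (vP i iV).2 /= racg_map_gen -kP.
  apply: (congr1 (racg_gen (K := KS sep S))).
  exact: qactE.
have lsub i j : subseq [:: i; j] l -> [/\ i \in l, j \in l & (i < j)%N].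
  move=> ij; split; try by apply: (mem_subseq ij); rewrite !inE eqxx ?orbT.
  have /(subseq_sorted ltn_trans ij) : sorted ltn l.
    by apply: sorted_filter (iota_ltn_sorted _ _); exact: ltn_trans.
  by rewrite /= andbT.
have same i j : subseq [:: i; j] l -> f i = f j -> v i = v j /\ h i = h j.
  move=> /lsub[/lP[iV _ _] /lP[jV jn _] ij] fij.
  have [vij kij] := qproj_representative_eq free V'_repr
     (vP i iV).1 (vP j jV).1 fij.
  split=> //; have [m mij hm] := hdist i j (ltnW ij).
  apply: (mulgI (h i)^-1); rewrite mulVg; apply/esym; apply: triv hm _ _.
    by lia.
  by rewrite gmulfM gmulfV -!kP -!fT kij mulVg.
rewrite wl; apply: (prod_reduction (f := f)).
- move=> i j ij /(same i j ij)[vij hij].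
  have [/lP[_ _ ->] /lP[_ _ ->] _] := lsub _ _ ij.
  suff -> : u i = u j by exact: racg_gen2.
  apply/qvertexP; exists (k j * (k i)^-1); last by rewrite actM actVK vij.
  by rewrite gmulfM gmulfV !kP hij mulgV.
- move=> i m j imj fij fim.
  have [im ij mj] : [/\ subseq [:: i; m] l, subseq [:: i; j] l & subseq [:: m; j] l].
    split; apply: subseq_trans imj.
    - exact: (prefix_subseq [:: i; m] [:: j]).
    - exact: (cat_subseq (subseq_refl [:: i]) (suffix_subseq [:: m] [:: j])).
    - exact: subseq_cons.
  have [vij hij] := same _ _ ij fij.
  have [/lP[iV _ ->] /lP[mV mn ->] ltim] := lsub _ _ im.
  have [_ /lP[_ jn _] ltmj] := lsub _ _ mj.
  apply: racg_gen_comm.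
  have [c [d [cd dN fc adjc]]] := adj_qproj_lift free V'_repr A_gen E'_repr
    cocompact E'_V' (vP i iV).1 (vP m mV).1 fim.
  (* As [h i = h j], the arcs from [i] to [m] and from [m] to [j] spell this element up to
     inversion; the shorter has length at most [(j - i) / 2 < n / 2], and [d <= N1 < n / 2]. *)
  have [p [ph pn]] : exists p,
      spelled (G_gens A S) ((h i)^-1 * h m) p /\ (p + d <= n)%N.
    have [p1 p1P sp1] := hdist i m (ltnW ltim).
    have [p2 p2P sp2] := hdist m j (ltnW ltmj).
    have [le|lt] := leqP p1 p2; first by exists p1; split=> //; lia.
    exists p2; split; last by lia.
    by rewrite hij -[h m]invgK -invgM; exact: spelledV.
  have g1 := triv _ _ (spelledM ph (spelled_image (from_empty G S) cd)) pn.
  have {}g1 : (h i)^-1 * h m * from_empty G S c = 1.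
    by apply: g1; rewrite -!kP -gmulfV -!gmulfM -fT.
  (* The lifted edge is translated by [k i]; [h i = h m c] places its second endpoint over [u m]. *)
  apply/asboolP; exists (act a (k i) (v i)), (act a (k i) (act a c^-1 (v m))).
  split=> //; last by rewrite act_adj.
  apply/qvertexP; exists (k i * c^-1 * (k m)^-1); last by rewrite !actM actVK.
  have hiE : h i = h m * from_empty G S c.
    by apply: (mulgI (h i)^-1); rewrite mulVg mulgA.
  by rewrite !gmulfM !gmulfV !kP hiE mulgK mulgV.
(* The letters [f i] spell the image of [w.1] in the Coxeter group of [K(T)], which is trivial. *)
- apply: reduction_racg1; rewrite big_map.
  transitivity (racg_map (KS_map sep hST) w.1); last first.
    by rewrite -[LHS]/((J_map sep hST w).1) w1.
  rewrite wl gmulf_prod [LHS]big_seq [RHS]big_seq.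
  apply: eq_bigr => i /lP[_ _ ->].
  rewrite /= racg_map_gen; apply: (congr1 (racg_gen (K := KS sep T))); apply/esym.
  exact: (qgraph_mapE sep (@KS_map_subproof _ _ _ hST)).
Qed.
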